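(* Let $X=[x_1,\dots,x_{r_+}]\in\mathbb{R}^{r\times r_+}$ be a stationary point of $f$, and for each $j$ let $t_j\in\{0,1\}^n$ be the indicator vector of the negative components of $Wx_j$. Let $S=(S_{ij})_{1\le i,j\le r_+}$ be the symmetric $rr_+\times rr_+$ matrix partitioned into $r\times r$ blocks $$S_{ij}=\begin{cases}\|x_i\|_2^2\,I_r+x_ix_i^T+\lambda W^T\mathrm{diag}(t_i)W+(XX^T-I_r), & i=j,\\ (x_i^Tx_j)\,I_r+x_jx_i^T, & i\ne j.\end{cases}$$ Suppose that either (i) $S$ is positive definite; or (ii) $S$ is positive semidefinite, its null space is spanned by vectors of the form $\mathrm{vec}(\Delta)$ (the stacked columns of $\Delta$) with $\Delta\in\mathbb{R}^{r\times r_+}$ satisfying $\Delta X^T+X\Delta^T=0$, and all nonzero eigenvalues of $S$ are not smaller than $\|X\|_2^2$. Then $X$ is a local minimizer of $f$.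
   Context: $A\in\mathbb{R}^{n\times n}$ is a completely positive matrix, i.e. $A=BB^T$ for some entrywise nonnegative matrix $B$; $r=\mathrm{rank}(A)$; the cp-rank $r_{cp}(A)$ is the smallest possible number of columns of such a $B$. $A=WW^T$ is a factorization with $W\in\mathbb{R}^{n\times r}$ of full column rank, $r_+\ge r_{cp}(A)$ is an integer, and $\lambda>0$. For a real matrix $Z$, $Z_-=\min\{Z,0\}$ (entrywise) denotes its negative part; $\|\cdot\|_F$ is the Frobenius norm and $\|\cdot\|_2$ the spectral norm (Euclidean norm for vectors). The function $f:\mathbb{R}^{r\times r_+}\to\mathbb{R}$ is $$f(X)=\tfrac14\|XX^T-I_r\|_F^2+\tfrac{\lambda}{2}\|(WX)_-\|_F^2 .$$ It is continuously differentiable with $\nabla f(X)=(XX^T-I_r)X+\lambda W^T(WX)_-$. A stationary point of $f$ is an $X$ with $\nabla f(X)=0$. *)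

(* Defs.v *)
From HB Require Import structures.
From mathcomp Require Import all_boot all_order all_algebra.
From mathcomp Require Import all_classical all_reals all_analysis.

Set Implicit Arguments.
Unset Strict Implicit.
Unset Printing Implicit Defensive.

Import Order.TTheory GRing.Theory Num.Theory.
Import numFieldNormedType.Exports.

Local Open Scope classical_set_scope.
Local Open Scope ring_scope.

Section Defs.
Context {R : realType}.

Definition frobenius_norm m n (Z : 'M[R]_(m, n)) : R :=
  Num.sqrt (\sum_i \sum_j Z i j ^+ 2).

Definition euclidean_norm n (v : 'cV[R]_n) : R :=
  Num.sqrt (\sum_i v i 0 ^+ 2).

Definition spectral_norm m n (Z : 'M[R]_(m, n)) : R :=
  sup [set euclidean_norm (Z *m v) | v in [set v : 'cV[R]_n | euclidean_norm v <= 1]].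

Definition negative_part m n (Z : 'M[R]_(m, n)) : 'M[R]_(m, n) :=
  map_mx (fun z => Num.min z 0) Z.

Definition posdef n (S : 'M[R]_n) : Prop :=
  forall v : 'cV[R]_n, v != 0 -> 0 < (v^T *m S *m v) 0 0.

Definition possemidef n (S : 'M[R]_n) : Prop :=
  forall v : 'cV[R]_n, 0 <= (v^T *m S *m v) 0 0.

Definition cp_factorable n (A : 'M[R]_n) (k : nat) : Prop :=
  exists B : 'M[R]_(n, k), (forall i j, 0 <= B i j) /\ A = B *m B^T.

Definition completely_positive n (A : 'M[R]_n) : Prop :=
  exists k, cp_factorable A k.

Lemma completely_positive_ex n (A : 'M[R]_n) :
  completely_positive A -> exists k, `[< cp_factorable A k >].
Proof. by case=> k Ak; exists k; apply/asboolP. Qed.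

Definition cp_rank n (A : 'M[R]_n) (cpA : completely_positive A) : nat :=
  ex_minn (completely_positive_ex cpA).

Definition objective n r rp (W : 'M[R]_(n, r)) (lambda : R)
    (X : 'M[R]_(r, rp)) : R :=
  4^-1 * frobenius_norm (X *m X^T - 1%:M) ^+ 2
  + lambda / 2 * frobenius_norm (negative_part (W *m X)) ^+ 2.

(* The gradient for the trace inner product. 'D_v is total, but this has its
   intended meaning below since [objective] is continuously differentiable. *)
Definition gradient m n (f : 'M[R]_(m, n) -> R) (X : 'M[R]_(m, n)) :
    'M[R]_(m, n) :=
  \matrix_(i, j) 'D_(delta_mx i j) f X.

Definition stationary_point m n (f : 'M[R]_(m, n) -> R) (X : 'M[R]_(m, n)) :
    Prop :=
  gradient f X = 0.

(* The topology on matrices is that of the entrywise max norm, hence the one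
   of the Frobenius norm. *)
Definition local_minimizer m n (f : 'M[R]_(m, n) -> R) (X : 'M[R]_(m, n)) :
    Prop :=
  \forall Y \near X, f X <= f Y.

Definition negative_indicator n (v : 'cV[R]_n) : 'cV[R]_n :=
  \col_i (v i 0 < 0)%R%:R.

Definition S_block n r rp (W : 'M[R]_(n, r)) (lambda : R)
    (X : 'M[R]_(r, rp)) (i j : 'I_rp) : 'M[R]_r :=
  if i == j then
    (euclidean_norm (col i X) ^+ 2)%:M + col i X *m (col i X)^T
    + lambda *: (W^T *m diag_mx (negative_indicator (W *m col i X))^T *m W)
    + (X *m X^T - 1%:M)
  else
    (((col i X)^T *m col j X) 0 0)%:M + col j X *m (col i X)^T.

(* The dimension \sum_(i < rp) r is the form of rp * r in which \mxblock and
   \mxcol are typed; S_mx and vec thus use the same indexing. *)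
Definition S_mx n r rp (W : 'M[R]_(n, r)) (lambda : R) (X : 'M[R]_(r, rp)) :
    'M[R]_(\sum_(i < rp) r) :=
  \mxblock_(i < rp, j < rp) S_block W lambda X i j.

Definition vec r rp (D : 'M[R]_(r, rp)) : 'cV[R]_(\sum_(i < rp) r) :=
  \mxcol_(i < rp) col i D.

Definition null_space_spanned_by m (S : 'M[R]_m) (s : seq 'cV[R]_m) : Prop :=
  forall v : 'cV[R]_m, S *m v = 0 <-> v \in span s.

End Defs.

(* Main.v *)
Require Import Defs.
From HB Require Import structures.
From mathcomp Require Import all_boot all_order all_algebra.
From mathcomp Require Import ring lra.
From mathcomp Require Import all_classical all_reals all_analysis.

Set Implicit Arguments.
Unset Strict Implicit.
Unset Printing Implicit Defensive.

Import Order.TTheory GRing.Theory Num.Theory.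
Import numFieldNormedType.Exports.
Local Open Scope ring_scope.

(** Write E = X X^T - I, L(D) = X D^T + D X^T, and let
      H_i = E + lambda W^T diag(t_i) W
    be what remains of the diagonal block S_ii once the pattern
    (x_i^T x_j) I + x_j x_i^T shared by all blocks of S is removed.
    Two facts drive the proof.

    First, there is an exact expansion of f(X + D) - f(X) ([objectiveD]): the
    linear term vanishes at a stationary point, the quartic term yields
    <E, D D^T>/2 + |L(D) + D D^T|^2/4, and the penalty leaves a sum of Bregman
    divergences of z |-> min(z, 0)^2, each at least t d^2 as long as no negative
    entry of W X has changed sign.  Hence, near X ([objective_ge]),
      f(X + D) - f(X) >= h(D)/2 + |L(D) + D D^T|^2/4,
    where h(D) = sum_i d_i^T H_i d_i.

    Secondly, S vec(D) = vec(L(D) X + [H_1 d_1, ..., H_rp d_rp])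
    ([S_mx_vec]), so that the quadratic form of S is h(D) + |L(D)|^2/2
    ([inner_S_mx_vec]).

    If S is positive definite, expanding the square turns the lower bound into
    half the quadratic form of S, plus |D D^T|^2/4, plus the cubic term
    <D D^T, D X^T>.  The last one is at least - eps r |D|^2 as soon as the
    entries of D X^T are at most eps ([inner_gram_ge]), and is absorbed by
    the coercivity of S.

    In the semidefinite case the reason is different: each H_i is then positive
    semidefinite ([curvature_block_ge0]), so that both terms of the lower bound
    are nonnegative for every D.  Indeed suppose that H_i y = a y with y nonzero
    and a < 0.  Stationarity says H_i x_i = 0, so y is orthogonal to x_i.  If
    vec(C) is in the null space of S then L(C) = 0, so H_i c_i = 0 and y is
    orthogonal to c_i: the matrix D whose i-th column is y, the others being
    zero, is thus orthogonal to the null space of S.  The quadratic form of S at D is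
    (|x_i|^2 + a) |y|^2 < |X|_2^2 |y|^2, whereas on the orthogonal complement
    of its null space it is at least |X|_2^2 |D|^2 by the assumption on the
    nonzero eigenvalues.

    The spectral facts about real symmetric matrices come from the minimization
    of the Rayleigh quotient on an invariant subspace ([rayleigh_min]). *)

(** * The Frobenius inner product *)

Section Inner.
Context {R : realType}.

(** The Frobenius inner product, written as a trace so that products can be
    moved from one side to the other by cyclicity. *)
Definition inner m n (A B : 'M[R]_(m, n)) : R := \tr (A *m B^T).

Lemma innerE m n (A B : 'M[R]_(m, n)) :
  inner A B = \sum_i \sum_j A i j * B i j.
Proof.
by apply: eq_bigr => i _; rewrite mxE; apply: eq_bigr => j _; rewrite mxE.
Qed.

Lemma innerC m n (A B : 'M[R]_(m, n)) : inner A B = inner B A.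
Proof. by rewrite /inner -mxtrace_tr trmx_mul trmxK. Qed.

Lemma innerDl m n (A B C : 'M[R]_(m, n)) :
  inner (A + B) C = inner A C + inner B C.
Proof. by rewrite /inner mulmxDl mxtraceD. Qed.

Lemma innerZl m n a (A C : 'M[R]_(m, n)) : inner (a *: A) C = a * inner A C.
Proof. by rewrite /inner -scalemxAl mxtraceZ. Qed.

Lemma innerDr m n (A B C : 'M[R]_(m, n)) :
  inner C (A + B) = inner C A + inner C B.
Proof. by rewrite !(innerC C) innerDl. Qed.

Lemma innerZr m n a (A C : 'M[R]_(m, n)) : inner C (a *: A) = a * inner C A.
Proof. by rewrite !(innerC C) innerZl. Qed.

Lemma inner0l m n (C : 'M[R]_(m, n)) : inner 0 C = 0.
Proof. by rewrite /inner mul0mx mxtrace0. Qed.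

Lemma innerBl m n (A B C : 'M[R]_(m, n)) :
  inner (A - B) C = inner A C - inner B C.
Proof. by rewrite innerDl -scaleN1r innerZl mulN1r. Qed.

Lemma inner_sqD m n (A B : 'M[R]_(m, n)) :
  inner (A + B) (A + B) = inner A A + 2 * inner A B + inner B B.
Proof. by rewrite innerDl !innerDr (innerC B A); ring. Qed.

Lemma inner_tr m n (A B : 'M[R]_(m, n)) : inner A^T B^T = inner A B.
Proof. by rewrite innerC /inner trmxK mxtrace_mulC. Qed.

Lemma inner_mulr m n p (A : 'M[R]_(m, n)) (B : 'M[R]_(n, p)) C :
  inner (A *m B) C = inner A (C *m B^T).
Proof. by rewrite /inner trmx_mul trmxK mulmxA. Qed.

Lemma inner_mull m n p (A : 'M[R]_(m, n)) (B : 'M[R]_(n, p)) C :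
  inner (A *m B) C = inner B (A^T *m C).
Proof. by rewrite -inner_tr trmx_mul inner_mulr -inner_tr !trmxK trmx_mul !trmxK. Qed.

Lemma inner_ge0 m n (A : 'M[R]_(m, n)) : 0 <= inner A A.
Proof.
rewrite innerE; apply: sumr_ge0 => i _; apply: sumr_ge0 => j _.
by rewrite -expr2 sqr_ge0.
Qed.

(** The parallelogram identity, without its other square. *)
Lemma inner_sqD_le m n (A B : 'M[R]_(m, n)) :
  inner (A + B) (A + B) <= 2 * (inner A A + inner B B).
Proof.
have := inner_ge0 (A + (-1) *: B).
by rewrite !inner_sqD !innerZl !innerZr; lra.
Qed.

Lemma inner_eq0 m n (A : 'M[R]_(m, n)) : (inner A A == 0) = (A == 0).
Proof.
apply/eqP/eqP => [|->]; last by rewrite inner0l.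
rewrite innerE => /eqP; rewrite psumr_eq0; last first.
  by move=> i _; apply: sumr_ge0 => j _; rewrite -expr2 sqr_ge0.
move=> /allP A0; apply/matrixP => i j; rewrite mxE.
have /(_ (mem_index_enum _)) := A0 i; rewrite psumr_eq0; last first.
  by move=> k _; rewrite -expr2 sqr_ge0.
by move=> /allP/(_ j (mem_index_enum _)); rewrite mulf_eq0 orbb => /eqP.
Qed.

Lemma inner_gt0 m n (A : 'M[R]_(m, n)) : (0 < inner A A) = (A != 0).
Proof. by rewrite lt_neqAle inner_ge0 andbT eq_sym inner_eq0. Qed.

Lemma inner_delta m n (A : 'M[R]_(m, n)) i j : inner A (delta_mx i j) = A i j.
Proof.
rewrite innerE (bigD1 i)//= (bigD1 j)//= mxE !eqxx mulr1.
rewrite [X in _ + X + _]big1 => [|l /negPf lj]; last first.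
  by rewrite mxE lj andbF mulr0.
rewrite big1 ?addr0// => k /negPf ki.
by apply: big1 => l _; rewrite mxE ki mulr0.
Qed.

Lemma inner_col m n (A B : 'M[R]_(m, n)) :
  inner A B = \sum_j inner (col j A) (col j B).
Proof.
rewrite innerE exchange_big; apply: eq_bigr => j _; rewrite innerE.
by apply: eq_bigr => i _; rewrite big_ord1 !mxE.
Qed.

Lemma sqr_frobenius_norm m n (A : 'M[R]_(m, n)) :
  frobenius_norm A ^+ 2 = inner A A.
Proof.
rewrite /frobenius_norm -[RHS]sqr_sqrtr ?inner_ge0// innerE.
by congr (Num.sqrt _ ^+ _).
Qed.

Lemma sqr_euclidean_norm n (v : 'cV[R]_n) : euclidean_norm v ^+ 2 = inner v v.
Proof.
rewrite /euclidean_norm -[RHS]sqr_sqrtr ?inner_ge0// innerE.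
congr (Num.sqrt _ ^+ _); apply: eq_bigr => i _.
by rewrite big_ord1 expr2.
Qed.

Lemma quadratic_form_inner n (M : 'M[R]_n) (v : 'cV[R]_n) :
  (v^T *m M *m v) 0 0 = inner v (M *m v).
Proof. by rewrite -trace_mx11 -mulmxA mxtrace_mulC innerC. Qed.

Lemma tr_mulmx_cV n (u v : 'cV[R]_n) : u^T *m v = (inner u v)%:M.
Proof. by rewrite [LHS]mx11_scalar -trace_mx11 mxtrace_mulC innerC. Qed.

Lemma col_mulmx m n p (A : 'M[R]_(m, n)) (B : 'M[R]_(n, p)) j :
  col j (A *m B) = A *m col j B.
Proof. by rewrite !colE mulmxA. Qed.

Lemma mulmx_tr_sum_col m n p (A : 'M[R]_(m, n)) (B : 'M[R]_(p, n)) :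
  A *m B^T = \sum_j col j A *m (col j B)^T.
Proof.
apply/matrixP => i k; rewrite mxE summxE; apply: eq_bigr => j _.
by rewrite [RHS]mxE big_ord1 !mxE.
Qed.

Lemma continuous_sum (T : topologicalType) (I : finType) (F : I -> T -> R) :
  (forall i, continuous (F i)) -> continuous (fun x => \sum_i F i x).
Proof.
by move=> Fc; apply: (continuous_big (@add_continuous R)) => i _; exact: Fc.
Qed.

(** The two-sided product covers at once the entries of W Y and of Y X^T. *)
Lemma continuous_mulmx_entry m n p q (A : 'M[R]_(p, m)) (B : 'M[R]_(n, q))
    i j : continuous (fun Y : 'M[R]_(m, n) => (A *m Y *m B) i j).
Proof.
have -> : (fun Y : 'M[R]_(m, n) => (A *m Y *m B) i j) =
    fun Y => \sum_l (\sum_k A i k * Y k l) * B l j.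
  by apply/funext => Y; rewrite mxE; under eq_bigr do rewrite mxE.
apply: continuous_sum => l Y; apply: (@cvgM _ _ (nbhs Y)); last exact: cvg_cst.
move: Y; apply: continuous_sum => k Y; apply: (@cvgM _ _ (nbhs Y)).
  exact: cvg_cst.
exact: coord_continuous.
Qed.
End Inner.

(** * Quadratic forms of symmetric matrices *)

Section Rayleigh.
Context {R : realType}.

Lemma inner_entry_le m n (A : 'M[R]_(m, n)) i j : A i j ^+ 2 <= inner A A.
Proof.
rewrite innerE (bigD1 i)//= (bigD1 j)//= -expr2 -addrA lerDl addr_ge0//.
  by apply: sumr_ge0 => k _; rewrite -expr2 sqr_ge0.
apply: sumr_ge0 => k _; apply: sumr_ge0 => l _.
by rewrite -expr2 sqr_ge0.
Qed.

Lemma continuous_quadratic m (M : 'M[R]_m) :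
  continuous (fun y : 'rV[R]_m => inner (y *m M) y).
Proof.
have -> : (fun y : 'rV[R]_m => inner (y *m M) y) =
    fun y => \sum_j (1%:M *m y *m M) 0 j * (1%:M *m y *m 1%:M) 0 j.
  by apply/funext => y; rewrite innerE big_ord1 mul1mx mulmx1.
apply: continuous_sum => j y.
by apply: (@cvgM _ _ (nbhs y)); apply: continuous_mulmx_entry.
Qed.

Lemma compact_kernel_sphere m k (B : 'M[R]_(m, k)) :
  compact [set y : 'rV[R]_m | y *m B = 0 /\ inner y y = 1]%classic.
Proof.
apply: bounded_closed_compact.
  exists 1; split => // c c1 y [_ y1].
  rewrite /= [leLHS]/Num.norm /= mx_normrE; apply/bigmax_leP; split=> [|[i j] _].
    by rewrite (le_trans ler01)// ltW.
  rewrite /= (le_trans _ (ltW c1))// -(@ler_pXn2r _ 2)// ?nnegrE//.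
  by rewrite real_normK ?num_real// expr1n -y1 inner_entry_le.
have -> : [set y : 'rV[R]_m | y *m B = 0 /\ inner y y = 1]%classic =
  ((\bigcap_(j in [set: 'I_k])
     (fun y : 'rV[R]_m => (1%:M *m y *m B) ord0 j) @^-1` [set x | x = 0]) `&`
   (fun y : 'rV[R]_m => inner (y *m 1%:M) y) @^-1` [set x | x = 1])%classic.
  apply/seteqP; split => y /=; rewrite mulmx1.
    by move=> [yB y1]; split => // j _ /=; rewrite mul1mx yB mxE.
  move=> [yB y1]; split => //; apply/rowP => j.
  by rewrite [RHS]mxE -(yB j Logic.I) mul1mx.
apply: closedI.
  apply: closed_bigI => j _; apply: (continuous_closedP _).1 (@closed_eq R _).
  exact: continuous_mulmx_entry.
apply: (continuous_closedP _).1 (@closed_eq R _).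
exact: continuous_quadratic.
Qed.

(** Minimizing the quadratic form of a symmetric matrix on the unit sphere of an
    invariant subspace, here the kernel of y |-> y B, yields an eigenvector in
    that subspace: the first variation at the minimizer y is orthogonal to
    every direction of the subspace, and y M - a y is such a direction by
    invariance. *)
Lemma rayleigh_min m k (M : 'M[R]_m) (B : 'M[R]_(m, k)) :
  M^T = M -> (forall y : 'rV[R]_m, y *m B = 0 -> y *m M *m B = 0) ->
  (exists2 z : 'rV[R]_m, z *m B = 0 & z != 0) ->
  exists (y : 'rV[R]_m) (a : R), [/\ y != 0, y *m B = 0, y *m M = a *: y &
    forall x : 'rV[R]_m, x *m B = 0 -> a * inner x x <= inner (x *m M) x].
Proof.
move=> Msym MB [z zB z0].
pose K := [set y : 'rV[R]_m | y *m B = 0 /\ inner y y = 1]%classic.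
have normalize (x : 'rV[R]_m) : x *m B = 0 -> x != 0 ->
    K ((Num.sqrt (inner x x))^-1 *: x).
  move=> xB x0; split; first by rewrite -scalemxAl xB scaler0.
  have xx : 0 < inner x x by rewrite inner_gt0.
  rewrite innerZl innerZr mulrA -invfM -expr2 sqr_sqrtr ?(ltW xx)//.
  by rewrite mulVf// gt_eqF.
have [||y /set_mem[yB y1] ymin] := @EVT_min_rV _ _
    (fun y => inner (y *m M) y) K _ (@compact_kernel_sphere m k B).
- by exists ((Num.sqrt (inner z z))^-1 *: z); exact: normalize.
- by apply: continuous_subspaceT; exact: continuous_quadratic.
set a := inner (y *m M) y in ymin.
have qmin (x : 'rV[R]_m) : x *m B = 0 -> a * inner x x <= inner (x *m M) x.
  move=> xB; have [->|x0] := eqVneq x 0.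
    by rewrite mul0mx !inner0l mulr0.
  have xx : 0 < inner x x by rewrite inner_gt0.
  have /mem_set/ymin := normalize x xB x0.
  rewrite -scalemxAl innerZl innerZr mulrA -invfM -expr2 sqr_sqrtr ?(ltW xx)//.
  by rewrite ler_pdivlMl// mulrC.
exists y, a; split => //; first by rewrite -inner_gt0 y1.
have [w wE] : exists w, w = y *m M - a *: y by exists (y *m M - a *: y).
have wB : w *m B = 0 by rewrite wE mulmxBl MB// -scalemxAl yB scaler0 subr0.
have sym : inner (w *m M) y = inner (y *m M) w.
  by rewrite inner_mulr Msym innerC.
have ww : inner w w = inner (y *m M) w - a * inner y w.
  by rewrite {1}wE innerBl innerZl.
set c := inner (w *m M) w - a * inner w w.
have var t : 0 <= 2 * t * inner w w + t ^+ 2 * c.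
  have := qmin (y + t *: w).
  rewrite mulmxDl yB -scalemxAl wB scaler0 addr0 => /(_ erefl).
  rewrite mulmxDl -scalemxAl !(innerDl, innerDr, innerZl, innerZr).
  rewrite sym (innerC w y) y1 -/a -subr_ge0 ww /c ww.
  by congr (_ <= _); rewrite -/c; ring.
apply/eqP; rewrite -subr_eq0 -wE -inner_eq0.
rewrite eq_le inner_ge0 andbT leNgt; apply/negP => w0.
have c0 : 0 < 1 + `|c| by rewrite ltr_pwDl.
(* Any small enough step of sign opposite to the first variation contradicts
   minimality; 1 + |c| keeps the quadratic term dominated. *)
have := var (- (inner w w / (1 + `|c|))).
set N := inner w w in w0 *; rewrite leNgt => /negP; apply.
have -> : 2 * - (N / (1 + `|c|)) * N + (- (N / (1 + `|c|))) ^+ 2 * c =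
  (N / (1 + `|c|)) ^+ 2 * (c - 2 * (1 + `|c|)) by field; rewrite gt_eqF.
rewrite pmulr_rlt0 ?exprn_gt0 ?divr_gt0// subr_lt0.
by have := ler_norm c; have := normr_ge0 c; lra.
Qed.

End Rayleigh.

Section SpectralBounds.
Context {R : realType}.

Lemma inner_mulmx_rV m (S : 'M[R]_m) (x : 'rV[R]_m) : S^T = S ->
  inner (x *m S) x = inner x^T (S *m x^T).
Proof. by move=> Ss; rewrite -{2}Ss -trmx_mul inner_tr innerC. Qed.

(** The least Rayleigh quotient is attained, hence positive. *)
Lemma posdef_coercive m (S : 'M[R]_m) : S^T = S -> posdef S ->
  exists2 c : R, 0 < c & forall v : 'cV[R]_m, c * inner v v <= inner v (S *m v).
Proof.
move=> Ssym Spos.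
have [[z z0]|noz] := pselect (exists z : 'rV[R]_m, z != 0); last first.
  (* In dimension 0 the unit sphere is empty and any constant will do. *)
  exists 1 => // v; have -> : v = 0; last by rewrite mulmx0 !inner0l mulr0.
  apply/eqP/negPn/negP => v0; apply: noz; exists v^T.
  by rewrite trmx_eq0.
(* A constraint matrix with no column selects the whole space. *)
have [||y [a [y0 _ yS ymin]]] := @rayleigh_min R m 0 S 0 Ssym.
- by move=> y _; rewrite mulmx0.
- by exists z => //; rewrite mulmx0.
exists a.
  have := Spos y^T; rewrite trmx_eq0 => /(_ y0).
  rewrite quadratic_form_inner -inner_mulmx_rV// yS innerZl.
  by rewrite pmulr_lgt0// inner_gt0.
move=> v; have := ymin v^T; rewrite mulmx0 => /(_ erefl).
by rewrite inner_tr inner_mulmx_rV// trmxK.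
Qed.

(** The orthogonal complement of the null space is invariant, and an eigenvector
    of S in it has a nonzero eigenvalue. *)
Lemma inner_kernel_ge m (S : 'M[R]_m) (c : R) (v : 'cV[R]_m) : S^T = S ->
  (forall a, eigenvalue S a -> a != 0 -> c <= a) ->
  (forall u : 'cV[R]_m, S *m u = 0 -> inner u v = 0) ->
  c * inner v v <= inner v (S *m v).
Proof.
move=> Ssym Seig vker.
have [->|v0] := eqVneq v 0; first by rewrite mulmx0 !inner0l mulr0.
(* y *m (kermx S)^T = 0 says that y is orthogonal to the null space of S. *)
have SK : S *m (kermx S)^T = 0 by rewrite -{1}Ssym -trmx_mul mulmx_ker trmx0.
have vK : v^T *m (kermx S)^T = 0.
  rewrite -trmx_mul; apply/eqP; rewrite trmx_eq0; apply/eqP/row_matrixP => k.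
  rewrite row0 row_mul -[row k _]trmxK tr_mulmx_cV vker ?scalemx0//.
    by apply/matrixP => i j; rewrite !mxE mul0rn.
  by rewrite -{1}Ssym -trmx_mul -row_mul mulmx_ker row0 trmx0.
have [||y [a [y0 yK yS ymin]]] := @rayleigh_min R m m S (kermx S)^T Ssym.
- by move=> y _; rewrite -mulmxA SK mulmx0.
- by exists v^T => //; rewrite trmx_eq0.
have a0 : a != 0.
  apply: contraNneq y0 => a0; move: yS; rewrite a0 scale0r => /sub_kermxP.
  move=> /submxP[b yE]; rewrite -inner_eq0 {2}yE innerC inner_mulr yK.
  by rewrite innerC inner0l.
have ca : c <= a by apply: Seig => //; apply/eigenvalueP; exists y.
have := ymin _ vK; rewrite inner_tr inner_mulmx_rV// trmxK.
by apply: le_trans; rewrite ler_wpM2r ?inner_ge0.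
Qed.

Lemma psd_of_eigen m (M : 'M[R]_m) : M^T = M ->
  (forall (y : 'cV[R]_m) (a : R), y != 0 -> M *m y = a *: y -> 0 <= a) ->
  forall v : 'cV[R]_m, 0 <= inner v (M *m v).
Proof.
move=> Msym Meig v.
have [->|v0] := eqVneq v 0; first by rewrite inner0l.
have [||y [a [y0 _ yM ymin]]] := @rayleigh_min R m 0 M 0 Msym.
- by move=> y _; rewrite mulmx0.
- by exists v^T; rewrite ?mulmx0// trmx_eq0.
have a0 : 0 <= a.
  apply: (Meig y^T); first by rewrite trmx_eq0.
  by rewrite -{1}Msym -trmx_mul yM linearZ.
have := ymin v^T; rewrite mulmx0 => /(_ erefl).
rewrite inner_tr inner_mulmx_rV// trmxK; apply: le_trans.
by rewrite mulr_ge0 ?inner_ge0.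
Qed.

Lemma col_norm_le_spectral m n (X : 'M[R]_(m, n)) i :
  inner (col i X) (col i X) <= spectral_norm X ^+ 2.
Proof.
have e1 : euclidean_norm (delta_mx i 0 : 'cV[R]_n) <= 1.
  rewrite -(@ler_pXn2r _ 2)// ?nnegrE ?sqrtr_ge0//.
  by rewrite sqr_euclidean_norm inner_delta mxE !eqxx expr1n.
suff le : euclidean_norm (col i X) <= spectral_norm X.
  rewrite -sqr_euclidean_norm ler_pXn2r// nnegrE ?sqrtr_ge0//.
  by apply: le_trans le; exact: sqrtr_ge0.
apply: sup_upper_bound; last by exists (delta_mx i 0); rewrite -?colE.
split; first by exists (euclidean_norm (col i X)), (delta_mx i 0); rewrite -?colE.
exists (Num.sqrt (\sum_k (\sum_j `|X k j|) ^+ 2)) => _ [v /= v1 <-].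
rewrite ler_wsqrtr//; apply: ler_sum => k _.
rewrite -real_normK ?num_real// ler_pXn2r ?nnegrE ?sumr_ge0//.
rewrite mxE (le_trans (ler_norm_sum _ _ _))//; apply: ler_sum => j _.
rewrite normrM ler_piMr// -(@ler_pXn2r _ 2)// ?nnegrE//.
rewrite real_normK ?num_real// (le_trans (inner_entry_le v j 0))//.
by rewrite -sqr_euclidean_norm ler_pXn2r// nnegrE ?sqrtr_ge0.
Qed.

(** The crude inequality 2 |D_ik D_jk| <= D_ik^2 + D_jk^2 suffices: the factor m
    is harmless because e can be taken small. *)
Lemma inner_gram_ge m p (M : 'M[R]_m) (D : 'M[R]_(m, p)) e :
  (forall i j, `|M i j| <= e) ->
  - (e * m%:R * inner D D) <= inner (D *m D^T) M.
Proof.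
move=> Me.
pose s i : R := \sum_k D i k ^+ 2.
have abs_le i j : `|(D *m D^T) i j * M i j| <= e / 2 * s i + e / 2 * s j.
  rewrite -mulrDr -mulrA normrM mulrC ler_pM// mxE -big_split mulr_sumr.
  rewrite (le_trans (ler_norm_sum _ _ _))//; apply: ler_sum => k _ /=.
  rewrite mxE ler_norml.
  by have := sqr_ge0 (D i k - D j k); have := sqr_ge0 (D i k + D j k); lra.
have DD : inner D D = \sum_i s i.
  by rewrite innerE; apply: eq_bigr => i _; apply: eq_bigr => k _; rewrite expr2.
have sumC c : \sum_(j < m) c = m%:R * c :> R.
  by rewrite sumr_const card_ord mulr_natl.
have -> : e * m%:R * inner D D =
    \sum_i \sum_j (e / 2 * s i + e / 2 * s j).
  transitivity (\sum_i (m%:R * (e / 2 * s i) + e / 2 * inner D D)).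
    by rewrite big_split/= sumC -mulr_sumr -mulr_sumr -DD; field.
  by apply: eq_bigr => i _; rewrite big_split/= sumC -mulr_sumr DD.
rewrite innerE -sumrN; apply: ler_sum => i _.
rewrite -sumrN; apply: ler_sum => j _.
by rewrite lerNl (le_trans _ (abs_le i j))// (le_trans (ler_norm _))// normrN.
Qed.

End SpectralBounds.

(** * Expansion and gradient of the objective *)

Section Expansion.
Context {R : realType}.

(** The Bregman divergence of the convex function z |-> min(z, 0)^2. *)
Definition neg_bregman (z d : R) : R :=
  Num.min (z + d) 0 ^+ 2 - Num.min z 0 ^+ 2 - 2 * Num.min z 0 * d.

Lemma neg_bregman_ge0 z d : 0 <= neg_bregman z d.
Proof.
rewrite /neg_bregman /Num.min.
by case: ltP => zd; case: ltP => z0; nra.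
Qed.

Lemma neg_bregman_le z d : neg_bregman z d <= d ^+ 2.
Proof.
rewrite /neg_bregman /Num.min.
by case: ltP => zd; case: ltP => z0; nra.
Qed.

(** Crossing from z < 0 to z + d >= 0 loses curvature: the bound d^2 needs that
    negative numbers stay negative. *)
Lemma neg_bregman_ge z d : (z < 0 -> z + d < 0) ->
  (z < 0)%R%:R * d ^+ 2 <= neg_bregman z d.
Proof.
move=> zd; case: (ltP z 0) => z0; last by rewrite mul0r neg_bregman_ge0.
by rewrite /neg_bregman /Num.min z0 (zd z0) mul1r; nra.
Qed.

Context (n r rp : nat) (W : 'M[R]_(n, r)) (lambda : R).
Implicit Types X D : 'M[R]_(r, rp).

Definition gram_defect X : 'M[R]_r := X *m X^T - 1%:M.

(** The differential at X, in the direction D, of X |-> X X^T. *)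
Definition gram_diff X D : 'M[R]_r := X *m D^T + D *m X^T.

Definition objective_grad X : 'M[R]_(r, rp) :=
  gram_defect X *m X + lambda *: (W^T *m negative_part (W *m X)).

Lemma gram_defect_sym X : (gram_defect X)^T = gram_defect X.
Proof. by rewrite /gram_defect linearB /= trmx_mul trmxK trmx1. Qed.

Lemma gram_diff_sym X D : (gram_diff X D)^T = gram_diff X D.
Proof. by rewrite /gram_diff linearD /= !trmx_mul !trmxK addrC. Qed.

Lemma inner_sym_gram_diff (M : 'M[R]_r) X D : M^T = M ->
  inner M (gram_diff X D) = 2 * inner (M *m X) D.
Proof.
move=> Ms; rewrite /gram_diff innerDr -{1}Ms -{1}[X]trmxK -trmx_mul inner_tr.
by rewrite mulr2n mulrDl mul1r inner_mulr.
Qed.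

Lemma sqnorm_negative_partD m p (Z D : 'M[R]_(m, p)) :
  inner (negative_part (Z + D)) (negative_part (Z + D)) =
  inner (negative_part Z) (negative_part Z) + 2 * inner (negative_part Z) D
  + \sum_i \sum_j neg_bregman (Z i j) (D i j).
Proof.
rewrite !innerE mulr_sumr -!big_split; apply: eq_bigr => i _.
rewrite /= mulr_sumr -!big_split; apply: eq_bigr => j _.
by rewrite !mxE /neg_bregman /=; ring.
Qed.

Lemma objectiveD X D :
  objective W lambda (X + D) = objective W lambda X
  + inner (objective_grad X) D
  + 2^-1 * inner (gram_defect X) (D *m D^T)
  + 4^-1 * inner (gram_diff X D + D *m D^T) (gram_diff X D + D *m D^T)
  + lambda / 2 *
    \sum_i \sum_j neg_bregman ((W *m X) i j) ((W *m D) i j).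
Proof.
rewrite /objective !sqr_frobenius_norm mulmxDr sqnorm_negative_partD.
have -> : (X + D) *m (X + D)^T - 1%:M =
    gram_defect X + (gram_diff X D + D *m D^T).
  rewrite linearD /= mulmxDl !mulmxDr /gram_defect /gram_diff -!addrA.
  by congr (_ + _); rewrite [RHS]addrC -!addrA.
have -> : inner (objective_grad X) D = inner (gram_defect X *m X) D
    + lambda * inner (negative_part (W *m X)) (W *m D).
  by rewrite innerDl innerZl [inner (W^T *m _) _]inner_mull trmxK.
set P := gram_diff X D + D *m D^T.
rewrite inner_sqD.
rewrite [inner _ P]innerDr inner_sym_gram_diff ?gram_defect_sym//.
by rewrite -/(gram_defect X); field.
Qed.

(** [objectiveD] gives a bound of this kind, because the Bregman divergences are
    at most quadratic in the step; the gradient thus follows without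
    differentiating the penalty. *)
Lemma derive_quadratic_remainder m p (f : 'M[R]_(m, p) -> R) a v (l C : R) :
  (forall h, `|h| <= 1 -> `|f (a + h *: v) - f a - h * l| <= C * h ^+ 2) ->
  'D_v f a = l.
Proof.
move=> fC; apply: cvg_lim => //; apply/cvgrPdist_le => e e0.
have C0 : 0 <= C by have := fC 1; rewrite normr1 expr1n mulr1 => /(_ (lexx _)); apply: le_trans.
near=> h.
have h0 : h != 0 by near: h; exact: nbhs_dnbhs_neq.
have h1 : `|h| <= 1 by near: h; exact: dnbhs0_le.
have he : `|h| <= e / (C + 1) by near: h; apply: dnbhs0_le; rewrite divr_gt0// ltr_wpDl.
rewrite distrC /= [h *: v + a]addrC.
have -> : h^-1 *: (f (a + h *: v) - f a) - l =
  h^-1 * (f (a + h *: v) - f a - h * l) by rewrite /GRing.scale/=; field.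
rewrite normrM normfV ler_pdivrMl ?normr_gt0// (le_trans (fC h h1))//.
rewrite -[h ^+ 2]real_normK ?num_real// expr2 mulrCA ler_pM2l ?normr_gt0//.
rewrite (le_trans (ler_wpM2l C0 he))// mulrCA ler_piMr ?(ltW e0)//.
by rewrite ler_pdivrMr ?ltr_wpDl// mul1r lerDl.
Unshelve. all: by end_near. Qed.

Lemma derive_objective X D :
  'D_D (objective W lambda) X = inner (objective_grad X) D.
Proof.
set E := inner (gram_defect X) (D *m D^T).
set LL := inner (gram_diff X D) (gram_diff X D).
set PP := inner (D *m D^T) (D *m D^T).
set WW := inner (W *m D) (W *m D).
apply: (@derive_quadratic_remainder _ _ _ _ _ _
  (2^-1 * `|E| + 2^-1 * (LL + PP) + `|lambda| / 2 * WW)) => h h1.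
rewrite objectiveD innerZr.
set S := \sum_i _.
have S0 : 0 <= S.
  by apply: sumr_ge0 => i _; apply: sumr_ge0 => j _; exact: neg_bregman_ge0.
have SW : S <= h ^+ 2 * WW.
  rewrite /WW innerE mulr_sumr; apply: ler_sum => i _.
  rewrite mulr_sumr; apply: ler_sum => j _.
  by rewrite (le_trans (neg_bregman_le _ _))// -scalemxAr mxE exprMn -expr2.
have -> : gram_diff X (h *: D) = h *: gram_diff X D.
  by rewrite /gram_diff linearZ /= -scalemxAr -scalemxAl scalerDr.
have -> : (h *: D) *m (h *: D)^T = h ^+ 2 *: (D *m D^T).
  by rewrite linearZ /= -scalemxAr -scalemxAl scalerA -expr2.
rewrite innerZr -/E.
have Q0 : 0 <= inner (h *: gram_diff X D + h ^+ 2 *: (D *m D^T))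
    (h *: gram_diff X D + h ^+ 2 *: (D *m D^T)) by exact: inner_ge0.
have Q1 : inner (h *: gram_diff X D + h ^+ 2 *: (D *m D^T))
    (h *: gram_diff X D + h ^+ 2 *: (D *m D^T)) <= 2 * h ^+ 2 * (LL + PP).
  rewrite (le_trans (inner_sqD_le _ _))// -[leRHS]mulrA ler_pM2l// mulrDr.
  rewrite !innerZl !innerZr -/LL -/PP.
  have h2 : h ^+ 2 <= 1 by rewrite -real_normK ?num_real// expr_le1.
  have := ler_wpM2r (mulr_ge0 (sqr_ge0 h) (inner_ge0 (D *m D^T))) h2.
  by rewrite -/PP mul1r; lra.
set Q := inner _ _ in Q0 Q1 *; set f0 := objective _ _ _; set g := inner _ D.
have -> : f0 + h * g + 2^-1 * (h ^+ 2 * E) + 4^-1 * Q + lambda / 2 * S - f0 - h * g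
   = h ^+ 2 * (2^-1 * E) + 4^-1 * Q + lambda / 2 * S by ring.
rewrite (le_trans (ler_normD _ _))// mulrDl lerD//.
  rewrite (le_trans (ler_normD _ _))// mulrDl lerD//.
    by rewrite normrM ger0_norm ?sqr_ge0// normrM (@ger0_norm _ 2^-1)// mulrC.
  by rewrite ger0_norm ?mulr_ge0// ?invr_ge0//; lra.
rewrite !normrM (ger0_norm S0) (@ger0_norm _ 2^-1)// -mulrA -[leRHS]mulrA.
by rewrite -[leRHS]mulrA !ler_wpM2l// mulrC.
Qed.

Lemma stationary_grad0 X :
  stationary_point (objective W lambda) X -> objective_grad X = 0.
Proof.
move=> /matrixP st; apply/matrixP => i j; rewrite [RHS]mxE.
by have := st i j; rewrite [LHS]mxE [RHS]mxE derive_objective inner_delta.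
Qed.

End Expansion.

(** * The block matrix S as an operator on matrices *)

Section Blocks.
Context {R : realType}.

Lemma inner_vec r rp (C D : 'M[R]_(r, rp)) : inner (vec C) (vec D) = inner C D.
Proof.
rewrite innerC [LHS]/inner mxtrace_mulC tr_mxcol mul_mxrow_mxcol raddf_sum inner_col.
by apply: eq_bigr => j _; rewrite /= mxtrace_mulC innerC.
Qed.

Lemma vec0 r rp : vec (0 : 'M[R]_(r, rp)) = 0.
Proof. by apply/matrixP => i j; rewrite !mxE. Qed.

Lemma vecD r rp (C D : 'M[R]_(r, rp)) : vec (C + D) = vec C + vec D.
Proof. by apply/matrixP => i j; rewrite !mxE. Qed.

Lemma vecZ r rp a (D : 'M[R]_(r, rp)) : vec (a *: D) = a *: vec D.
Proof. by apply/matrixP => i j; rewrite !mxE. Qed.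

Context (n r rp : nat) (W : 'M[R]_(n, r)) (lambda : R) (X : 'M[R]_(r, rp)).
Implicit Types D : 'M[R]_(r, rp).

(** What distinguishes the diagonal blocks of S from the formula
    (x_i^T x_j) I + x_j x_i^T of the other ones. *)
Definition curvature_block (i : 'I_rp) : 'M[R]_r :=
  lambda *: (W^T *m diag_mx (negative_indicator (W *m col i X))^T *m W)
  + gram_defect X.

Definition curvature D : R :=
  \sum_i inner (col i D) (curvature_block i *m col i D).

Lemma curvature_block_sym i : (curvature_block i)^T = curvature_block i.
Proof.
rewrite /curvature_block linearD /= gram_defect_sym linearZ /= !trmx_mul.
by rewrite tr_diag_mx trmxK mulmxA.
Qed.

Lemma S_blockE i j : S_block W lambda X i j =
  (inner (col i X) (col j X))%:M + col j X *m (col i X)^T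
  + (if i == j then curvature_block i else 0).
Proof.
rewrite /S_block; case: eqP => [<-|_].
  by rewrite sqr_euclidean_norm [RHS]addrA.
by rewrite tr_mulmx_cV mxE mulr1n addr0.
Qed.

Lemma S_mx_sym : (S_mx W lambda X)^T = S_mx W lambda X.
Proof.
rewrite /S_mx tr_mxblock; apply/eq_mxblockP => i j; rewrite !S_blockE.
rewrite !linearD /= tr_scalar_mx trmx_mul trmxK innerC; congr (_ + _).
rewrite eq_sym; case: eqP => [->|_]; last exact: trmx0.
exact: curvature_block_sym.
Qed.

Definition S_action D : 'M[R]_(r, rp) :=
  gram_diff X D *m X + \matrix_(k, i) (curvature_block i *m col i D) k 0.

Lemma col_S_action D i :
  col i (S_action D) = gram_diff X D *m col i X + curvature_block i *m col i D.
Proof.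
rewrite /S_action linearD /= col_mulmx; congr (_ + _).
by apply/matrixP => k l; rewrite [LHS]mxE [LHS]mxE ord1.
Qed.

(** The part of S common to all blocks is the Gauss-Newton operator
    D |-> L(D) X of the residual X X^T - I; it vanishes where L(D) does. *)
Lemma S_mx_vec D : S_mx W lambda X *m vec D = vec (S_action D).
Proof.
rewrite /S_mx /vec mul_mxblock_mxrow; apply/eq_mxcolP => i.
rewrite col_S_action /gram_diff mulmxDl [X *m D^T]mulmx_tr_sum_col.
rewrite [D *m X^T]mulmx_tr_sum_col !mulmx_suml -big_split/=.
rewrite [X in _ = _ + X](_ : _ = \sum_j
    (if i == j then curvature_block i else 0) *m col j D); last first.
  rewrite (bigD1 i)//= eqxx big1 ?addr0// => j ji.
  by rewrite eq_sym (negPf ji) mul0mx.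
rewrite -big_split/=; apply: eq_bigr => j _.
rewrite S_blockE !mulmxDl; congr (_ + _).
rewrite addrC -!mulmxA !tr_mulmx_cV mul_scalar_mx !mul_mx_scalar.
by rewrite (innerC (col j X)) (innerC (col j D)).
Qed.

Lemma inner_S_mx_vec D : inner (vec D) (S_mx W lambda X *m vec D) =
  curvature D + 2^-1 * inner (gram_diff X D) (gram_diff X D).
Proof.
rewrite S_mx_vec inner_vec innerDr addrC; congr (_ + _).
  rewrite inner_col; apply: eq_bigr => i _; congr (inner _ _).
  by apply/matrixP => k l; rewrite [LHS]mxE [LHS]mxE ord1.
rewrite inner_sym_gram_diff ?gram_diff_sym// mulKf//.
by rewrite innerC.
Qed.

Lemma diag_quadratic m (d : 'cV[R]_m) (v : 'cV[R]_m) :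
  inner v (diag_mx d^T *m v) = \sum_i d i 0 * v i 0 ^+ 2.
Proof.
rewrite innerE; apply: eq_bigr => i _.
by rewrite big_ord1 mul_diag_mx !mxE mulrCA -expr2.
Qed.

Lemma curvatureE D : curvature D =
  lambda * \sum_i \sum_j ((W *m X) i j < 0)%R%:R * (W *m D) i j ^+ 2
  + inner (gram_defect X) (D *m D^T).
Proof.
have -> : inner (gram_defect X) (D *m D^T) =
    \sum_j inner (col j D) (gram_defect X *m col j D).
  rewrite -inner_mulr innerC inner_col; apply: eq_bigr => j _.
  by rewrite col_mulmx.
rewrite exchange_big mulr_sumr -big_split; apply: eq_bigr => j _ /=.
rewrite mulmxDl innerDr; congr (_ + _).
rewrite -scalemxAl innerZr -!mulmxA innerC inner_mull trmxK innerC.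
rewrite diag_quadratic; congr (_ * _); apply: eq_bigr => i _.
by rewrite -!col_mulmx !mxE.
Qed.

Lemma negative_part_diag m (v : 'cV[R]_m) :
  negative_part v = diag_mx (negative_indicator v)^T *m v.
Proof.
apply/matrixP => i j; rewrite mul_diag_mx !mxE ord1 /Num.min.
by case: ltP => _; rewrite ?mul1r ?mul0r.
Qed.

(** The negative part of W x_i is diag(t_i) W x_i, so the columns of the gradient
    are the H_i x_i: stationarity puts x_i in the kernel of H_i. *)
Lemma curvature_block_col i :
  curvature_block i *m col i X = col i (objective_grad W lambda X).
Proof.
rewrite /curvature_block /objective_grad mulmxDl addrC linearD /= !col_mulmx.
rewrite linearZ /= -scalemxAl col_mulmx -!mulmxA -negative_part_diag.
congr (_ + _ *: (_ *m _)); rewrite -col_mulmx.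
by apply/matrixP => k l; rewrite !mxE.
Qed.

End Blocks.

(** * Local lower bound of the objective *)

Section Local.
Context {R : realType}.
Context (n r rp : nat) (W : 'M[R]_(n, r)) (lambda : R) (X : 'M[R]_(r, rp)).
Context (lambda_gt0 : 0 < lambda).
Context (statX : stationary_point (objective W lambda) X).

(** A negative entry of W X stays negative in a neighbourhood of X, where each
    Bregman divergence is therefore bounded below by its second-order term. *)
Lemma objective_ge : \forall Y \near X,
  objective W lambda X + 2^-1 * curvature W lambda X (Y - X)
    + 4^-1 * inner (gram_diff X (Y - X) + (Y - X) *m (Y - X)^T)
                   (gram_diff X (Y - X) + (Y - X) *m (Y - X)^T)
  <= objective W lambda Y.
Proof.
have near_neg : \forall Y \near X,
    forall i j, (W *m X) i j < 0 -> (W *m Y) i j < 0.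
  apply: (@filter_forall _ _ _ (nbhs X)) => i.
  apply: (@filter_forall _ _ _ (nbhs X)) => j.
  have [WX|WX] := ltP ((W *m X) i j) 0; last by apply: nearW.
  have WX1 : (W *m X *m 1%:M) i j < 0 by rewrite mulmx1.
  have cX := @continuous_mulmx_entry R r rp n rp W 1%:M i j X.
  near=> Y => _; rewrite -[W *m Y]mulmx1; near: Y.
  exact: (cvgr_lt _ cX).
near=> Y; have Yneg : forall i j, (W *m X) i j < 0 -> (W *m Y) i j < 0.
  by near: Y.
rewrite -{8}[Y](subrKC X); set D := Y - X.
rewrite objectiveD stationary_grad0// inner0l addr0 curvatureE.
have : \sum_i \sum_j ((W *m X) i j < 0)%R%:R * (W *m D) i j ^+ 2 <=
   \sum_i \sum_j neg_bregman ((W *m X) i j) ((W *m D) i j).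
  apply: ler_sum => i _; apply: ler_sum => j _; apply: neg_bregman_ge.
  move=> /Yneg; congr (_ < 0).
  by rewrite -{1}[Y](subrKC X) mulmxDr mxE.
by move/(ler_wpM2l (ltW lambda_gt0)); lra.
Unshelve. all: by end_near. Qed.

End Local.

(** * The two sufficient conditions *)

Section Cases.
Context {R : realType}.
Context (n r rp : nat) (W : 'M[R]_(n, r)) (lambda : R) (X : 'M[R]_(r, rp)).
Context (lambda_gt0 : 0 < lambda).
Context (statX : stationary_point (objective W lambda) X).

Lemma near_mulmx_tr e : 0 < e ->
  \forall Y \near X, forall i j, `|((Y - X) *m X^T) i j| <= e.
Proof.
move=> e0.
apply: (@filter_forall _ _ _ (nbhs X)) => i.
apply: (@filter_forall _ _ _ (nbhs X)) => j.
have cX := @continuous_mulmx_entry R r rp r r 1%:M X^T i j X.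
have := cX; move=> /cvgrPdist_le/(_ e e0) Ye.
near=> Y.
have : `|(1%:M *m X *m X^T) i j - (1%:M *m Y *m X^T) i j| <= e by near: Y.
by rewrite !mul1mx distrC mulmxBl [X in _ -> `|X| <= _]mxE [X in _ -> `|_ + X| <= _]mxE.
Unshelve. all: by end_near. Qed.

Lemma local_minimizer_of_posdef : posdef (S_mx W lambda X) ->
  local_minimizer (objective W lambda) X.
Proof.
move=> /(posdef_coercive (S_mx_sym _ _ _))[c c0 coer].
(* The threshold c / (2 (r + 1)) makes the cubic term at least - (c/2) |D|^2. *)
have e0 : 0 < c / 2 / (r%:R + 1) by rewrite !divr_gt0// ltr_wpDl.
near=> Y.
have small : forall i j, `|((Y - X) *m X^T) i j| <= c / 2 / (r%:R + 1).
  by near: Y; exact: near_mulmx_tr.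
have : objective W lambda X + 2^-1 * curvature W lambda X (Y - X)
    + 4^-1 * inner (gram_diff X (Y - X) + (Y - X) *m (Y - X)^T)
                   (gram_diff X (Y - X) + (Y - X) *m (Y - X)^T)
  <= objective W lambda Y by near: Y; exact: objective_ge.
apply: le_trans; rewrite -addrA lerDl.
move: (Y - X) small => D small.
have := coer (vec D); rewrite inner_S_mx_vec inner_vec inner_sqD.
have -> : inner (gram_diff X D) (D *m D^T) = 2 * inner (D *m D^T) (D *m X^T).
  rewrite innerC inner_sym_gram_diff; last by rewrite trmx_mul trmxK.
  by rewrite inner_mulr -inner_tr trmx_mul !trmxK -inner_tr !trmx_mul !trmxK.
have := inner_gram_ge D small.
have : c / 2 / (r%:R + 1) * r%:R * inner D D <= c / 2 * inner D D.
  rewrite ler_wpM2r ?inner_ge0// -mulrA ger_pMr ?divr_gt0//.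
  by rewrite mulrC ler_pdivrMr ?ltr_wpDl// mul1r lerDl.
by have := inner_ge0 (D *m D^T); lra.
Unshelve. all: by end_near. Qed.

Section Semidefinite.
Context (s : seq 'M[R]_(r, rp)).
Context (s_diff : forall D, D \in s -> D *m X^T + X *m D^T = 0).
Context (s_span : null_space_spanned_by (S_mx W lambda X) (map (@vec R r rp) s)).
Context (S_eig : forall a : R, eigenvalue (S_mx W lambda X) a -> a != 0 ->
  spectral_norm X ^+ 2 <= a).

Lemma null_space_gram_diff u : S_mx W lambda X *m u = 0 ->
  exists2 D, u = vec D & gram_diff X D = 0.
Proof.
move=> /s_span /(@coord_span _ _ _ (in_tuple _)) ->.
apply: (big_ind (fun u => exists2 D, u = vec D & gram_diff X D = 0)).
- by exists 0; rewrite ?vec0// /gram_diff trmx0 mulmx0 mul0mx addr0.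
- move=> _ _ [C -> C0] [D -> D0]; exists (C + D); first by rewrite vecD.
  rewrite /gram_diff linearD /= mulmxDr mulmxDl addrACA.
  by rewrite -/(gram_diff X C) -/(gram_diff X D) C0 D0 addr0.
- move=> i _.
  have /mapP[D Ds ->] := mem_nth 0 (ltn_ord i).
  move: (coord _ _ _) => a; exists (a *: D); first by rewrite vecZ.
  rewrite /gram_diff linearZ /= -scalemxAr -scalemxAl -scalerDr.
  by rewrite addrC s_diff// scaler0.
Qed.

(** A negative eigenvalue a of H_i would give a matrix with a single nonzero
    column, orthogonal to the null space of S, where the Rayleigh quotient of S
    is |x_i|^2 + a < |X|_2^2. *)
Lemma curvature_block_ge0 i (y : 'cV[R]_r) :
  0 <= inner y (curvature_block W lambda X i *m y).
Proof.
apply: psd_of_eigen => [|{}y a y0 Hy]; first exact: curvature_block_sym.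
rewrite leNgt; apply/negP => a0.
have Hx : curvature_block W lambda X i *m col i X = 0.
  by rewrite curvature_block_col stationary_grad0//; apply/matrixP => k l; rewrite !mxE.
have orth (z : 'cV[R]_r) : curvature_block W lambda X i *m z = 0 -> inner y z = 0.
  move=> Hz; have : a * inner y z = 0.
    by rewrite -innerZl -Hy inner_mull curvature_block_sym Hz innerC inner0l.
  by move/eqP; rewrite mulf_eq0 lt_eqF// => /eqP.
pose D : 'M[R]_(r, rp) := y *m delta_mx 0 i.
have colD j : col j D = if j == i then y else 0.
  rewrite /D col_mulmx; apply/matrixP => k l.
  rewrite mxE big_ord1 !mxE eqxx (ord1 l)/=.
  by case: (j == i); rewrite ?mulr1 ?mulr0 ?mxE.
have sum1 (F : 'I_rp -> 'cV[R]_r) : \sum_j inner (col j D) (F j) = inner y (F i).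
  rewrite (bigD1 i)//= colD eqxx big1 ?addr0// => j /negPf ji.
  by rewrite colD ji inner0l.
have vker u : S_mx W lambda X *m u = 0 -> inner u (vec D) = 0.
  move=> Su; have [C uC C0] := null_space_gram_diff Su.
  rewrite uC innerC inner_vec inner_col sum1; apply: orth.
  have := Su; rewrite uC S_mx_vec => /(congr1 (fun v => submxcol v i)).
  by rewrite /vec mxcolK submxcol0 col_S_action C0 mul0mx add0r.
have := inner_kernel_ge (S_mx_sym W lambda X) S_eig vker.
have yX : inner y (col i X) = 0 by exact: orth.
have LX : gram_diff X D *m col i X = inner (col i X) (col i X) *: y.
  rewrite /gram_diff mulmxDl /D trmx_mul trmx_delta -!mulmxA [y^T *m _]tr_mulmx_cV.
  rewrite yX raddf0 !mulmx0 add0r [delta_mx _ _ *m _]mulmxA -rowE -tr_col.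
  by rewrite tr_mulmx_cV mul_mx_scalar.
rewrite S_mx_vec !inner_vec !inner_col !sum1 colD eqxx col_S_action.
rewrite colD eqxx LX Hy -scalerDl innerZr.
rewrite ler_pM2r ?inner_gt0// leNgt => /negP; apply.
by have := col_norm_le_spectral X i; lra.
Qed.

Lemma local_minimizer_of_possemidef : local_minimizer (objective W lambda) X.
Proof.
near=> Y.
have : objective W lambda X + 2^-1 * curvature W lambda X (Y - X)
    + 4^-1 * inner (gram_diff X (Y - X) + (Y - X) *m (Y - X)^T)
                   (gram_diff X (Y - X) + (Y - X) *m (Y - X)^T)
  <= objective W lambda Y by near: Y; exact: objective_ge.
apply: le_trans; rewrite -addrA lerDl addr_ge0// mulr_ge0// ?inner_ge0//.
by apply: sumr_ge0 => i _; exact: curvature_block_ge0.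
Unshelve. all: by end_near. Qed.

End Semidefinite.
End Cases.

Theorem theorem1 (R : realType) (n r rp : nat) (A : 'M[R]_n)
    (cpA : completely_positive A) (rankA : \rank A = r)
    (W : 'M[R]_(n, r)) (AW : A = W *m W^T) (rankW : \rank W = r)
    (le_cp_rank : (cp_rank cpA <= rp)%N)
    (lambda : R) (lambda_gt0 : 0 < lambda)
    (X : 'M[R]_(r, rp)) (statX : stationary_point (objective W lambda) X) :
  posdef (S_mx W lambda X)
  \/ [/\ possemidef (S_mx W lambda X),
         (exists s : seq 'M[R]_(r, rp),
            (forall D, D \in s -> D *m X^T + X *m D^T = 0)
            /\ null_space_spanned_by (S_mx W lambda X) (map (@vec R r rp) s))
       & (forall a : R, eigenvalue (S_mx W lambda X) a -> a != 0 ->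
            spectral_norm X ^+ 2 <= a)] ->
  local_minimizer (objective W lambda) X.
Proof.
case=> [Spos|[_ [s [s_diff s_span]] S_eig]].
  exact: local_minimizer_of_posdef.
exact: (local_minimizer_of_possemidef _ _ s_diff s_span S_eig).
Qed.
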